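(* Let $G=(V,E)$ be a finite graph with neither loops nor multiple edges. Let $0<a_2\le a_1=1$, $p_1,p_2\in(0,1)$, $q_1,q_2\in[1,\infty)$. Let $r_i=\sqrt{1-p_i}$, and let $\Upsilon_i=\Upsilon_{a_i,p_i,q_i}$ be the marginal on $\Omega=\{0,1\}^E$ of the diluted-random-cluster measure $\phi_{a_i,p_i,q_i}$ on $G$, for $i=1,2$. (a) If $q_2\le q_1$ and $$\frac{1-p_2}{p_2}\,(1+2w_\delta+w_\delta w_{\delta-1})\le\frac{1-p_1}{p_1},$$ where $\delta$ is the maximum vertex-degree of $G$ and $$w_j=\frac1{q_2r_2^j}\Big(\frac{1-a_2}{a_2}\Big),\qquad j=0,1,2,\dots,\delta,$$ then $\Upsilon_1\le_{\rm st}\Upsilon_2$. (b) If $p_1\ge p_2$ and $q_1\le q_2$, then $\Upsilon_1\ge_{\rm st}\Upsilon_2$.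
   Context: Let $\Psi=\{0,1\}^V$, $\Omega=\{0,1\}^E$. For $\psi\in\Psi$ let $V_\psi=\{x\in V:\psi_x=1\}$ and $E_\psi=\{\langle x,y\rangle\in E:x,y\in V_\psi\}$; for $\omega\in\Omega$ let $\eta(\omega)=\{e\in E:\omega_e=1\}$. Let $\Theta$ be the set of pairs $(\psi,\omega)\in\Psi\times\Omega$ with $\eta(\omega)\subseteq E_\psi$, and for $\theta=(\psi,\omega)\in\Theta$ let $k(\theta)$ be the number of connected components of the graph $(V_\psi,\eta(\omega))$. With $r=\sqrt{1-p}$, the diluted-random-cluster measure on $G$ with parameters $a\in(0,1]$, $p\in[0,1)$, $q\in(0,\infty)$ is the probability measure on $\Psi\times\Omega$ given by $$\phi_{a,p,q}(\theta)=\frac1Z\,r^{|E_\psi|}q^{k(\theta)}\prod_{x\in V}\Big(\frac a{1-a}\Big)^{\psi_x}\prod_{e\in E_\psi}\Big(\frac p{1-p}\Big)^{\omega_e},\qquad\theta=(\psi,\omega)\in\Theta,$$ and $\phi_{a,p,q}(\theta)=0$ otherwise, with $Z$ the normalizing constant. When $a=1$ the formula is interpreted as requiring that all vertices be open (i.e. $\psi\equiv1$), so that $\omega$ then has the usual random-cluster law on $G$ with weights proportional to $q^{k(\omega)}(p/(1-p))^{|\eta(\omega)|}$. The edge-marginal is $\Upsilon_{a,p,q}(\omega)=\sum_{\psi\in\Psi}\phi_{a,p,q}(\psi,\omega)$. For probability measures $\mu_1,\mu_2$ on $\{0,1\}^I$, with the coordinatewise partial order, $\mu_1\le_{\rm st}\mu_2$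 (equivalently $\mu_2\ge_{\rm st}\mu_1$) means $\mu_1(f)\le\mu_2(f)$ for all increasing functions $f:\{0,1\}^I\to\mathbb R$, where $\mu(f)$ denotes expectation. *)

(* Defs.v *)
From mathcomp Require Import all_boot all_order all_algebra.

Set Implicit Arguments.
Unset Strict Implicit.
Unset Printing Implicit Defensive.

Import Order.TTheory GRing.Theory Num.Theory.
Local Open Scope ring_scope.

(* A finite graph G = (V, E) without loops or multiple edges is given by a
   finite type V and a set E of two-element subsets of V. *)
Definition simple_graph (V : finType) (E : {set {set V}}) : Prop :=
  forall e : {set V}, e \in E -> #|e| = 2%N.

Notation edge E := {e : {set _} | e \in E}.

Definition degree (V : finType) (E : {set {set V}}) (x : V) : nat :=
  #|[set e in E | x \in e]|.

Definition max_degree (V : finType) (E : {set {set V}}) : nat :=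
  \max_(x : V) degree E x.

(* The configuration space {0,1}^I. *)
Notation config I := {ffun I -> bool}.

Definition open_vertices (V : finType) (psi : config V) : {set V} :=
  [set x | psi x].

(* E_psi *)
Definition available_edges (V : finType) (E : {set {set V}})
    (psi : config V) : {set edge E} :=
  [set e : edge E | val e \subset open_vertices psi].

(* eta(omega) *)
Definition open_edges (V : finType) (E : {set {set V}})
    (omega : config (edge E)) : {set edge E} :=
  [set e : edge E | omega e].

(* Theta *)
Definition compatible (V : finType) (E : {set {set V}})
    (psi : config V) (omega : config (edge E)) : bool :=
  open_edges omega \subset available_edges E psi.

Definition open_adj (V : finType) (E : {set {set V}})
    (omega : config (edge E)) : rel V :=
  [rel x y | [exists e in open_edges omega, val e == [set x; y]]].

(* k(theta). For compatible (psi, omega) the set of open vertices is closed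
   under open_adj omega, so n_comp counts the components of (V_psi, eta(omega));
   other pairs are given weight 0 below. *)
Definition num_components (V : finType) (E : {set {set V}})
    (psi : config V) (omega : config (edge E)) : nat :=
  n_comp (open_adj omega) (open_vertices psi).

(* (a / (1 - a)) ^ b, except that for a = 1 a closed vertex gets weight 0 and
   an open one weight 1, which forces all vertices to be open. *)
Definition vertex_weight (R : fieldType) (a : R) (b : bool) : R :=
  if a == 1 then b%:R else (a / (1 - a)) ^+ b.

Definition drc_weight (R : rcfType) (V : finType) (E : {set {set V}})
    (a p q : R) (psi : config V) (omega : config (edge E)) : R :=
  if compatible psi omega then
    Num.sqrt (1 - p) ^+ #|available_edges E psi|
    * q ^+ num_components psi omega
    * (\prod_(x : V) vertex_weight a (psi x))
    * (\prod_(e in available_edges E psi) (p / (1 - p)) ^+ (omega e))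
  else 0.

(* Z *)
Definition drc_partition (R : rcfType) (V : finType) (E : {set {set V}})
    (a p q : R) : R :=
  \sum_(psi : config V) \sum_(omega : config (edge E))
    drc_weight a p q psi omega.

(* Probability measures on the finite spaces considered here are represented
   by their point masses. *)
Definition drc_measure (R : rcfType) (V : finType) (E : {set {set V}})
    (a p q : R) (psi : config V) (omega : config (edge E)) : R :=
  drc_weight a p q psi omega / drc_partition E a p q.

(* Upsilon *)
Definition edge_marginal (R : rcfType) (V : finType) (E : {set {set V}})
    (a p q : R) (omega : config (edge E)) : R :=
  \sum_(psi : config V) drc_measure a p q psi omega.

Definition expectation (R : numDomainType) (I : finType)
    (mu f : config I -> R) : R :=
  \sum_(omega : config I) mu omega * f omega.

Definition increasing_fun (R : numDomainType) (I : finType)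
    (f : config I -> R) : Prop :=
  forall omega omega' : config I,
    (forall i : I, (omega i <= omega' i)%N) -> f omega <= f omega'.

Definition st_le (R : numDomainType) (I : finType)
    (mu1 mu2 : config I -> R) : Prop :=
  forall f : config I -> R, increasing_fun f ->
    expectation mu1 f <= expectation mu2 f.

(* w_j = (q r^j)^-1 (1 - a) / a, with r = sqrt(1 - p) *)
Definition w_coef (R : rcfType) (a p q : R) (j : nat) : R :=
  1 / (q * Num.sqrt (1 - p) ^+ j) * ((1 - a) / a).

(* Main.v *)
Require Import Defs.
From mathcomp Require Import all_boot all_order all_algebra.
From mathcomp Require Import zify ring lra.

Set Implicit Arguments.
Unset Strict Implicit.
Unset Printing Implicit Defensive.

Import Order.TTheory GRing.Theory Num.Theory.
Local Open Scope ring_scope.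

(* Closed vertices are isolated in the open graph, so summing over the set D of
   closed vertices gives, up to a constant factor,
     Upsilon(C) = q^k(C) (p/(1-p))^|C| A(C),
     A(C) = \sum_D t^|D| s^|incident D|,   t = (1-a)/(a q),  s = 1/r,
   where D ranges over the sets of isolated vertices of (V, C), incident D is
   the set of edges meeting D, and k(C) is the number of components of (V, C).
   For a = 1, A = 1, so Upsilon_1 is a random-cluster measure; since q_1 >= 1
   and k is supermodular, it satisfies the FKG inequality. It remains to see
   that Upsilon_2 / Upsilon_1 is increasing in case (a) and decreasing in case
   (b). Adding an edge does not increase k or A, which gives (b). For (a),
   adding the edge <x,y> divides A by at most the sum of the weights of the
   possible intersections of D with {x, y}, which is bounded by
   1 + 2 w_delta + w_delta w_(delta-1): the edge <x,y> meets both endpoints, so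
   {x, y} is incident to at most 2 delta - 1 edges. *)

(** * Correlation inequalities on the lattice of subsets *)

(** The four functions theorem over a one-point set, with index 1 when the point is present; it
    drives the induction in [four_functions]. *)
Lemma four_functions_bool (R : realFieldType) (a0 a1 b0 b1 c0 c1 d0 d1 : R) :
    0 <= a0 -> 0 <= a1 -> 0 <= b0 -> 0 <= b1 ->
    0 <= c0 -> 0 <= c1 -> 0 <= d0 -> 0 <= d1 ->
    a0 * b0 <= c0 * d0 -> a0 * b1 <= c1 * d0 ->
    a1 * b0 <= c1 * d0 -> a1 * b1 <= c1 * d1 ->
  (a0 + a1) * (b0 + b1) <= (c0 + c1) * (d0 + d1).
Proof.
move=> a0_ge0 a1_ge0 b0_ge0 b1_ge0 c0_ge0 c1_ge0 d0_ge0 d1_ge0 h00 h01 h10 h11.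
have huv : (a0 * b1) * (a1 * b0) <= (c1 * d0) * (c0 * d1).
  have -> : a0 * b1 * (a1 * b0) = (a0 * b0) * (a1 * b1) by ring.
  have -> : c1 * d0 * (c0 * d1) = (c0 * d0) * (c1 * d1) by ring.
  by apply: ler_pM => //; apply: mulr_ge0.
(* [h00] and [h11] settle the diagonal products; only the mixed ones remain. *)
suff : a0 * b1 + a1 * b0 <= c1 * d0 + c0 * d1 by lra.
have N_ge0 : 0 <= c0 * d1 by apply: mulr_ge0.
have M_ge0 : 0 <= c1 * d0 by apply: mulr_ge0.
move: huv h01 h10 N_ge0 M_ge0.
move: (a0 * b1) (a1 * b0) (c1 * d0) (c0 * d1) => u v M N huv huM hvM N_ge0.
rewrite le_eqVlt => /predU1P[M0|M_gt0]; first by lra.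
rewrite -(ler_pM2l M_gt0).
(* uv <= MN gives M (M + N - u - v) >= (M - u)(M - v) >= 0. *)
have := mulr_ge0 (_ : 0 <= M - u) (_ : 0 <= M - v).
rewrite !subr_ge0 => /(_ huM hvM); lra.
Qed.

Lemma sum_subsetU1 (R : nmodType) (T : finType) (x : T) (S : {set T})
    (g : {set T} -> R) : x \notin S ->
  \sum_(A : {set T} | A \subset x |: S) g A =
  \sum_(A : {set T} | A \subset S) (g A + g (x |: A)).
Proof.
move=> xS; rewrite (bigID (fun A : {set T} => x \in A)) /= addrC big_split /=.
congr (_ + _).
  apply: eq_bigl => A; apply/andP/idP => [[sA xA]|sA].
    apply/subsetP => y yA; have := subsetP sA y yA; rewrite !inE.
    by case/predU1P => // yx; rewrite -yx yA in xA.
  by rewrite (subset_trans sA (subsetUr _ _)) (contra (subsetP sA x)).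
rewrite (reindex_onto (fun A => x |: A) (fun A => A :\ x)) /=; last first.
  by move=> A /andP[_ xA]; rewrite setD1K.
apply: eq_bigl => A; rewrite setU11 andbT.
apply/andP/idP => [[sA /eqP eA]|sA].
  rewrite -eA; apply/subsetP => y; rewrite !inE => /andP[yx yxA].
  have := subsetP sA y; rewrite !inE yxA (negPf yx) /=; exact.
by rewrite setUS ?setU1K // (contra (subsetP sA x)).
Qed.

Section FourFunctions.
Variables (R : realFieldType) (T : finType).
Implicit Types (A B S : {set T}) (f : {set T} -> R).

(** The Ahlswede-Daykin inequality, by induction on the ground set [S]: summing out a point [x]
    turns each function [f] into [A |-> f A + f (x |: A)] on subsets of [S :\ x], and the hypothesis
    survives. *)
Theorem four_functions f1 f2 f3 f4 :
    (forall A, 0 <= f1 A) -> (forall A, 0 <= f2 A) ->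
    (forall A, 0 <= f3 A) -> (forall A, 0 <= f4 A) ->
    (forall A B, f1 A * f2 B <= f3 (A :|: B) * f4 (A :&: B)) ->
  (\sum_A f1 A) * (\sum_A f2 A) <= (\sum_A f3 A) * (\sum_A f4 A).
Proof.
move=> f1_ge0 f2_ge0 f3_ge0 f4_ge0 hf.
suff gen S : (forall A B, A \subset S -> B \subset S ->
      f1 A * f2 B <= f3 (A :|: B) * f4 (A :&: B)) ->
    (\sum_(A : {set T} | A \subset S) f1 A)
      * (\sum_(A : {set T} | A \subset S) f2 A)
    <= (\sum_(A : {set T} | A \subset S) f3 A)
      * (\sum_(A : {set T} | A \subset S) f4 A).
  have sT f : \sum_(A : {set T} | A \subset setT) f A = \sum_A f A.
    by apply: eq_bigl => A; rewrite subsetT.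
  by have := gen setT (fun A B _ _ => hf A B); rewrite !sT.
move: {hf} (refl_equal #|S|); move: {2}#|S| => n.
elim: n => [|n IHn] in S f1 f2 f3 f4 f1_ge0 f2_ge0 f3_ge0 f4_ge0 *.
  move/cards0_eq->; move=> /(_ set0 set0 (subxx _) (subxx _)).
  have s0 f : \sum_(A : {set T} | A \subset set0) f A = f set0.
    by rewrite (big_pred1 set0) // => A; rewrite subset0.
  by rewrite !s0 setU0 setI0.
move=> cS hf; have [x xS] : exists x, x \in S.
  by apply/set0Pn; rewrite -card_gt0 cS.
pose S' := S :\ x; have xS' : x \notin S' by rewrite !inE eqxx.
rewrite -(setD1K xS) -/S' !sum_subsetU1 //.
apply: IHn => [A|A|A|A||A B sA sB]; rewrite ?addr_ge0 //.
  by have := cardsD1 x S; rewrite xS cS => -[].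
have sS'S : S' \subset S by apply: subsetDl.
have [sA' sB'] := (subset_trans sA sS'S, subset_trans sB sS'S).
have xA : x \notin A by apply: contra xS'; apply: subsetP.
have xB : x \notin B by apply: contra xS'; apply: subsetP.
have sxA : x |: A \subset S by rewrite subUset sub1set xS.
have sxB : x |: B \subset S by rewrite subUset sub1set xS.
(* When exactly one of the two sets contains [x], their union does and their intersection does not,
   whence [c1 * d0] in both mixed cases. *)
apply: four_functions_bool; rewrite ?addr_ge0 //.
- exact: hf.
- have := hf A (x |: B) sA' sxB.
  rewrite setUCA (_ : A :&: (x |: B) = A :&: B) //.
  apply/setP => y; rewrite !inE; case: eqP => [->|//].
  by rewrite (negPf xA).
- have := hf (x |: A) B sxA sB'.
  rewrite -setUA (_ : (x |: A) :&: B = A :&: B) //.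
  apply/setP => y; rewrite !inE; case: eqP => [->|//].
  by rewrite (negPf xB) !andbF.
- by have := hf (x |: A) (x |: B) sxA sxB; rewrite -setUUr -setUIr.
Qed.

(** Subtracting from [f] and [g] their least values, attained at [set0], does not change the
    difference of the two sides. Once both are nonnegative, [four_functions] applies, with the
    product of [f] and [g] evaluated at the union. *)
Theorem fkg (m f g : {set T} -> R) :
    (forall A, 0 <= m A) ->
    (forall A B, m A * m B <= m (A :|: B) * m (A :&: B)) ->
    (forall A B, A \subset B -> f A <= f B) ->
    (forall A B, A \subset B -> g A <= g B) ->
  (\sum_A m A * f A) * (\sum_A m A * g A)
    <= (\sum_A m A * (f A * g A)) * (\sum_A m A).
Proof.
move=> m_ge0 hm fS gS.
pose f' A := f A - f set0; pose g' A := g A - g set0.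
have f'_ge0 A : 0 <= f' A by rewrite subr_ge0 fS ?sub0set.
have g'_ge0 A : 0 <= g' A by rewrite subr_ge0 gS ?sub0set.
have : (\sum_A m A * f' A) * (\sum_A m A * g' A)
    <= (\sum_A m A * (f' A * g' A)) * (\sum_A m A).
  apply: four_functions => [A|A|A|A|A B]; rewrite ?mulr_ge0 //.
  rewrite mulrACA [leRHS]mulrAC ler_pM ?mulr_ge0 //.
  by rewrite ler_pM // lerD2r ?fS ?gS ?subsetUl ?subsetUr.
have E h : \sum_A m A * (h A - h set0)
    = \sum_A m A * h A - (\sum_A m A) * h set0.
  by rewrite mulr_suml -sumrB; apply: eq_bigr => A _; rewrite mulrBr.
have Efg : \sum_A m A * (f' A * g' A)
    = \sum_A m A * (f A * g A) - (\sum_A m A * f A) * g set0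
      - (\sum_A m A * g A) * f set0 + (\sum_A m A) * (f set0 * g set0).
  rewrite !mulr_suml -!sumrB -big_split /=; apply: eq_bigr => A _.
  rewrite /f' /g'; ring.
rewrite Efg !E; lra.
Qed.

Lemma homo_subset_setU1 f :
    (forall x A, x \notin A -> f A <= f (x |: A)) ->
  forall A B, A \subset B -> f A <= f B.
Proof.
move=> fU A B /setUidPr <-; elim: {B}_.+1 {-2}B (ltnSn #|B|) => // n IHn B.
have [->|/set0Pn[x xB]] := eqVneq B set0; first by rewrite setU0.
rewrite (cardsD1 x) xB ltnS => /IHn /le_trans; apply.
rewrite -{2}(setD1K xB) setUCA.
have [xA|xA] := boolP (x \in A :|: B :\ x); last exact: fU.
by rewrite (_ : x |: _ = A :|: B :\ x) //; apply/setUidPr; rewrite sub1set.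
Qed.

End FourFunctions.

(** * Supermodularity of the number of components *)

(** One-point increments that grow with the set suffice: the elements of [F] are added one by one to
    both [X] and [Y], and the increments are summed. *)
Lemma supermodular_setU1 (T : finType) (k : {set T} -> nat) :
    (forall x (A B : {set T}), A \subset B ->
      (k (x |: A) + k B <= k (x |: B) + k A)%N) ->
  forall A B : {set T}, (k A + k B <= k (A :|: B) + k (A :&: B))%N.
Proof.
move=> kU A B.
suff gen (X Y F : {set T}) : X \subset Y ->
    (k (F :|: X) + k Y <= k (F :|: Y) + k X)%N.
  have := gen (A :&: B) A B (subsetIl _ _).
  by rewrite setUIr setUid [B :|: A]setUC (setIidPr (subsetUr _ _)) addnC.
move=> sXY; elim: {F}_.+1 {-2}F (ltnSn #|F|) => // n IHn F.
have [->|/set0Pn[x xF]] := eqVneq F set0; first by rewrite !set0U addnC.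
rewrite (cardsD1 x) xF ltnS => /IHn IH.
have := kU x (F :\ x :|: X) (F :\ x :|: Y) (setUS _ sXY).
by rewrite !setUA setD1K //; lia.
Qed.

(** Let [a] be the union of the [e]-components of [x] and [y]. Off [a] the two relations have the
    same components; inside it [e'] has one, and [e] has one or two according to whether [x] and [y]
    are already connected. *)
Lemma n_comp_add_edge (T : finType) (e e' : rel T) (x y : T) :
    symmetric e -> symmetric e' -> subrel e e' -> e' x y ->
    (forall u v, e' u v -> e u v \/ [set u; v] = [set x; y]) ->
  (n_comp e' T + ~~ connect e x y = n_comp e T)%N.
Proof.
move=> /sym_connect_sym se /sym_connect_sym se' ee' exy e'E.
pose a := closure e (pred2 x y).
have xa : x \in a by apply: mem_closure; rewrite inE eqxx.
have ya : y \in a by apply: mem_closure; rewrite inE eqxx orbT.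
have set2P u v : [set u; v] = [set x; y] ->
    (u = x \/ u = y) /\ (v = x \/ v = y).
  by move=> uv; split; apply/set2P; rewrite -uv ?set21 ?set22.
have cl_a : closed e a by apply: closure_closed.
have cl_a' : closed e' a.
  move=> u v /e'E[/cl_a//|/set2P[]].
  by move=> [->|->] [->|->]; rewrite ?xa ?ya.
have sub_connect u v : connect e u v -> connect e' u v.
  by apply: connect_sub => {}u {}v /ee'; apply: connect1.
have aE : a =i closure e' (pred2 x y).
  move=> z; rewrite /a !unfold_in; apply/pred0Pn/pred0Pn => -[w /andP[zw wxy]].
    by exists w; apply/andP; split=> //; apply: sub_connect.
  have /= := closed_connect cl_a' zw.
  rewrite [in RHS](_ : w \in a) => [|]; last by case/pred2P: wxy => ->.
  by rewrite unfold_in => /pred0Pn.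
have nC : n_comp e' [predC a] = n_comp e [predC a].
  apply: eq_card => z; rewrite !inE; case: (boolP (z \in a)) => za.
    by rewrite !andbF.
  rewrite !andbT.
  suff H : connect e' z =1 connect e z.
    have rz : fingraph.root e' z = fingraph.root e z
      by rewrite /fingraph.root (eq_pick H).
    by rewrite /roots rz.
  have nzx w : w = x \/ w = y -> connect e z w = false.
    move=> wxy; apply: contraNF za => /(closed_connect cl_a)->.
    by case: wxy => ->.
  (* The new edge has no endpoint in the [e]-component of [z], so no [e']-step leaves it. *)
  have cl_z : closed e' (connect e z).
    move=> u v /e'E[euv|/set2P[/nzx + /nzx]]; first exact: connect_closed euv.
    by move=> zu zv; exact: etrans zu (esym zv).
  move=> w; apply/idP/idP => [|/sub_connect//].
  by move/(closed_connect cl_z) => zw; exact: etrans (esym zw) (connect0 e z).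
rewrite (n_compC a e') // (n_compC a e) // nC.
rewrite (eq_n_comp_r aE) !n_comp_closure2 //.
by rewrite (connect1 exy) addnAC.
Qed.

Definition adj (V : finType) (E : {set {set V}}) (C : {set edge E}) :
    rel V :=
  [rel x y | [exists e in C, val e == [set x; y]]].

(** All of [V] is counted, so closed vertices appear as singleton components and the count depends
    on the edge set alone. *)
Definition components (V : finType) (E : {set {set V}})
    (C : {set edge E}) : nat :=
  n_comp (adj C) V.

Section Components.
Variables (V : finType) (E : {set {set V}}).
Hypothesis hE : simple_graph E.
Implicit Types (C D : {set edge E}) (e : edge E).

Lemma adj_sym C : symmetric (adj C).
Proof. by move=> x y; rewrite /adj /= (setUC [set x]). Qed.

Lemma edge_ends e : exists x y, x != y /\ val e = [set x; y].
Proof. by have /eqP/cards2P[x [y [xy eE]]] := hE (valP e); exists x, y. Qed.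

Lemma components_setU1 e C x y : val e = [set x; y] ->
  (components (e |: C) + ~~ connect (adj C) x y = components C)%N.
Proof.
move=> exy; apply: n_comp_add_edge; try exact: adj_sym.
- move=> u v /existsP[f /andP[fC fE]]; apply/existsP; exists f.
  by rewrite !inE fC orbT.
- by apply/existsP; exists e; rewrite !inE eqxx exy /=.
- move=> u v /existsP[f /andP[]]; rewrite !inE.
  case/predU1P => [-> /eqP <-|fC fE]; first by right.
  by left; apply/existsP; exists f; rewrite fC.
Qed.

Lemma components_setU1_le e C : (components (e |: C) <= components C)%N.
Proof.
have [x [y [_ exy]]] := edge_ends e.
by rewrite -(components_setU1 C exy) leq_addr.
Qed.

(** A new edge lowers the count by one exactly when its ends are not yet connected, which becomes
    rarer as the edge set grows. *)
Lemma components_supermodular C D :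
  (components C + components D
    <= components (C :|: D) + components (C :&: D))%N.
Proof.
apply: supermodular_setU1 => {C D} e C D sCD.
have [x [y [_ exy]]] := edge_ends e.
rewrite -(components_setU1 D exy) -(components_setU1 C exy).
rewrite addnCA leq_add2l leq_add2l.
suff : connect (adj C) x y -> connect (adj D) x y.
  by case: (connect (adj C) x y) (connect (adj D) x y) => - [] // /(_ isT).
apply: connect_sub => u v.
move=> /existsP[f /andP[fC fE]]; apply/connect1/existsP; exists f.
by rewrite (subsetP sCD).
Qed.

End Components.

(** * The sum over sets of closed vertices *)

Section Dilution.
Variables (R : rcfType) (V : finType) (E : {set {set V}}).
Implicit Types (C : {set edge E}) (D F : {set V}) (e : edge E).

Definition isolated C : {set V} := [set x | [forall e in C, x \notin val e]].

Definition incident D : {set edge E} :=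
  [set e : edge E | ~~ [disjoint val e & D]].

Lemma isolatedS C C' : C \subset C' -> isolated C' \subset isolated C.
Proof.
move=> /subsetP sC; apply/subsetP => x; rewrite !inE => /forall_inP h.
by apply/forall_inP => e /sC/h.
Qed.

Lemma incidentU D F : incident (D :|: F) = incident D :|: incident F.
Proof.
by apply/setP => e; rewrite !inE -!setI_eq0 setIUr setU_eq0 negb_and.
Qed.

Lemma incident1 x : incident [set x] = [set e : edge E | x \in val e].
Proof. by apply/setP => e; rewrite !inE disjoint_sym disjoints1 negbK. Qed.

Lemma card_incident1 x : (#|incident [set x]| <= max_degree E)%N.
Proof.
rewrite incident1 -(card_imset _ val_inj).
apply: leq_trans (leq_bigmax (F := degree E) x); apply: subset_leq_card.
apply/subsetP => _ /imsetP[e + ->]; rewrite !inE => ->.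
by rewrite (valP e).
Qed.

Lemma card_incident_edge e x y : val e = [set x; y] ->
  (#|incident [set x; y]| <= max_degree E + (max_degree E).-1)%N.
Proof.
move=> exy; have ye : e \in incident [set y].
  by rewrite incident1 inE exy set22.
have : incident [set x; y] \subset incident [set x] :|: incident [set y] :\ e.
  rewrite incidentU; apply/subsetP => f.
  rewrite !in_setU in_setD1; case: eqVneq => //= -> _.
  by rewrite incident1 inE exy set21.
move=> /subset_leq_card/leq_trans; apply.
apply: leq_trans (leq_card_setU _ _) _.
apply: leq_add (card_incident1 x) _.
(* The predecessor is a true subtraction here: [e] itself makes the degree of [y] positive. *)
by have := card_incident1 y; rewrite (cardsD1 e) ye; case: max_degree.
Qed.

(** The relative weight of closing [D] when its vertices are isolated: each vertex costs a component
    and its vertex weight, and each edge meeting [D] costs a factor [r]. *)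
Definition dilution_weight (t s : R) D : R := t ^+ #|D| * s ^+ #|incident D|.

Definition dilution_sum (t s : R) C : R :=
  \sum_(D : {set V} | D \subset isolated C) dilution_weight t s D.

Variables (t s : R).
Hypotheses (t_ge0 : 0 <= t) (s_ge1 : 1 <= s).

Let s_ge0 : 0 <= s. Proof. exact: le_trans s_ge1. Qed.

Lemma dilution_weight_ge0 D : 0 <= dilution_weight t s D.
Proof. by rewrite mulr_ge0 ?exprn_ge0. Qed.

Lemma dilution_sum_gt0 C : 0 < dilution_sum t s C.
Proof.
rewrite /dilution_sum (bigD1 set0) ?sub0set //= ltr_pwDl ?sumr_ge0 //.
  rewrite /dilution_weight cards0 expr0 mul1r exprn_gt0 //.
  exact: lt_le_trans s_ge1.
by move=> D _; apply: dilution_weight_ge0.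
Qed.

Lemma sum_dilution_weightS (S S' : {set V}) : S \subset S' ->
  \sum_(D : {set V} | D \subset S) dilution_weight t s D
    <= \sum_(D : {set V} | D \subset S') dilution_weight t s D.
Proof.
move=> sS; rewrite [leRHS](bigID (fun D : {set V} => D \subset S)) /=.
rewrite [X in _ <= X + _](eq_bigl (fun D : {set V} => D \subset S)) => [|D].
  by rewrite lerDl sumr_ge0 // => D _; apply: dilution_weight_ge0.
by apply: andb_idl => /subset_trans; apply.
Qed.

Lemma dilution_sumS C C' : C \subset C' ->
  dilution_sum t s C' <= dilution_sum t s C.
Proof. by move=> sC; apply/sum_dilution_weightS/isolatedS. Qed.

(** Edges meeting both [F] and [D] are counted twice in the bound, which only enlarges it because
    [s] is at least 1. *)
Lemma dilution_weightU F D n : [disjoint F & D] -> (#|incident F| <= n)%N ->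
  dilution_weight t s (F :|: D) <= t ^+ #|F| * s ^+ n * dilution_weight t s D.
Proof.
move=> dFD nF; rewrite /dilution_weight incidentU.
rewrite -(leq_card_setU F D) in dFD; rewrite (eqP dFD).
rewrite mulrACA -!exprD ler_wpM2l ?exprn_ge0 // ler_weXn2l //.
by rewrite (leq_trans (leq_card_setU _ _)) ?leq_add2r.
Qed.

Lemma dilution_sum_setU1 e C (d := max_degree E) : #|val e| = 2%N ->
  dilution_sum t s C
    <= (1 + 2 * (t * s ^+ d) + t * s ^+ d * (t * s ^+ d.-1))
       * dilution_sum t s (e |: C).
Proof.
move=> /eqP/cards2P[x [y [xy exy]]].
set J := isolated (e |: C).
have eJ z : z \in val e -> z \notin J.
  move=> ze; rewrite inE; apply/negP => /forall_inP/(_ e).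
  by rewrite setU11 ze => /(_ isT).
have xJ : x \notin J by rewrite eJ // exy set21.
have yJ : y \notin J by rewrite eJ // exy set22.
(* Only an inclusion holds, since [x] and [y] may be ends of other edges of [C]; an upper bound
   needs no more. *)
have sJ : isolated C \subset x |: (y |: J).
  apply/subsetP => z; rewrite !inE => /forall_inP zC.
  case: eqVneq => //= zx; case: eqVneq => //= zy.
  apply/forall_inP => f; rewrite !inE => /predU1P[->|/zC//].
  by rewrite exy !inE negb_or zx.
apply: le_trans (sum_dilution_weightS sJ) _.
have xyJ : x \notin y |: J by rewrite in_setU1 negb_or xy xJ.
(* The sum splits by the trace on the edge, in the order empty, [x], [y], both; each trace is then
   bounded for fixed [D]. *)
rewrite (sum_subsetU1 _ xyJ) (sum_subsetU1 _ yJ).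
rewrite mulr_sumr; apply: ler_sum => D sD.
have xD : x \notin D by apply: contra xJ; apply: subsetP.
have yD : y \notin D by apply: contra yJ; apply: subsetP.
have hx := dilution_weightU (F := [set x]) (D := D) _ (card_incident1 x).
have hy := dilution_weightU (F := [set y]) (D := D) _ (card_incident1 y).
have hxy :=
  dilution_weightU (F := [set x; y]) (D := D) _ (card_incident_edge exy).
move: hx hy hxy; rewrite !cards1 cards2 xy !disjoints1.
rewrite -setI_eq0 setIUl setU_eq0 !setI_eq0 !disjoints1 xD yD !expr1 -setUA.
move=> /(_ isT) hx /(_ isT) hy /(_ isT); rewrite exprD -/d => hxy.
apply: le_trans (lerD (lerD (lexx _) hx) (lerD hy hxy)) _.
rewrite le_eqVlt; apply/orP/or_introl/eqP; rewrite -/d.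
move: (s ^+ d) (s ^+ d.-1) (dilution_weight t s D) => u v g.
rewrite -[true.+1]/2%N; ring.
Qed.

End Dilution.

(** The case [a = 1], where [t = 0] leaves only the empty set of closed vertices. *)
Lemma dilution_sum0 (R : rcfType) (V : finType) (E : {set {set V}}) (s : R)
  (C : {set edge E}) : dilution_sum 0 s C = 1.
Proof.
rewrite /dilution_sum (bigD1 set0) ?sub0set //= big1 => [|D /andP[_ D0]].
  rewrite addr0 /dilution_weight cards0.
  rewrite (_ : incident E set0 = set0) ?cards0 ?mul1r //.
  by apply/setP => e; rewrite !inE -setI_eq0 setI0 eqxx.
by rewrite /dilution_weight expr0n cards_eq0 (negPf D0) mul0r.
Qed.

(** * The edge-marginal as a weight on edge sets *)

Section Marginal.
Variables (R : rcfType) (V : finType) (E : {set {set V}}).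
Implicit Types (C : {set edge E}) (D : {set V}).

Definition config_of_set (T : finType) (A : {set T}) : config T :=
  [ffun x => x \in A].

Lemma config_of_set_bij (T : finType) : bijective (@config_of_set T).
Proof.
exists (fun f : config T => [set x | f x]) => [A|f].
  by apply/setP => x; rewrite inE ffunE.
by apply/ffunP => x; rewrite ffunE inE.
Qed.

Lemma open_edges_config C : open_edges (config_of_set C) = C.
Proof. by apply/setP => e; rewrite inE ffunE. Qed.

Lemma open_vertices_config D : open_vertices (config_of_set D) = D.
Proof. by apply/setP => e; rewrite inE ffunE. Qed.

Lemma available_edges_compl D :
  available_edges E (config_of_set (~: D)) = ~: incident E D.
Proof.
apply/setP => e; rewrite !inE open_vertices_config negbK.
by rewrite -disjoints_subset.
Qed.

Lemma compatible_compl D C :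
  compatible (config_of_set (~: D)) (config_of_set C) = (D \subset isolated C).
Proof.
rewrite /compatible open_edges_config available_edges_compl.
apply/subsetP/subsetP => [h x xD|h e eC].
  rewrite inE; apply/forall_inP => e /h; rewrite !inE negbK => /disjointFr.
  by move=> d; apply: contraTN xD => /d->.
rewrite !inE negbK; apply/pred0P => x /=; apply/andP => -[xe /h].
by rewrite inE => /forall_inP/(_ e eC); rewrite xe.
Qed.

(** Each vertex of [D] is a component by itself in the graph on all of [V], hence its own root: a
    nontrivial path to the root would start with an open edge at it. *)
Lemma num_components_compl D C : D \subset isolated C ->
  (num_components (config_of_set (~: D)) (config_of_set C) + #|D|
   = components C)%N.
Proof.
move=> sD; rewrite /num_components open_vertices_config.
rewrite (_ : n_comp _ _ = n_comp (adj C) (~: D)); last first.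
  apply: eq_n_comp => x y; apply: eq_connect => {}x {}y.
  by rewrite /open_adj open_edges_config.
rewrite /components (n_compC (~: D)); congr (_ + _)%N.
apply: eq_card => x; rewrite !inE negbK andb_idl // => xD.
rewrite /roots; apply/eqP; have /connectP[[|z p] //=] := connect_root (adj C) x.
case/andP=> /existsP[e /andP[eC /eqP exz]].
have := subsetP sD x xD; rewrite inE => /forall_inP/(_ e eC).
by rewrite exz set21.
Qed.

(** The first two factors depend on neither [D] nor [C] and will cancel on normalizing. For [a = 1]
    the power of [(1 - a) / a = 0] vanishes unless [D] is empty, as the convention requires. *)
Lemma drc_weight_compl (a p q : R) D C : 0 < a <= 1 -> 0 < p < 1 -> 0 < q ->
  drc_weight a p q (config_of_set (~: D)) (config_of_set C)
  = (if a == 1 then 1 else a / (1 - a)) ^+ #|V|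
    * Num.sqrt (1 - p) ^+ #|{: edge E}|
    * (if D \subset isolated C then
         q ^+ components C * (p / (1 - p)) ^+ #|C|
         * dilution_weight E ((1 - a) / a / q) (Num.sqrt (1 - p))^-1 D
       else 0).
Proof.
move=> /andP[a_gt0 a_le1] /andP[p_gt0 p_lt1] q_gt0.
rewrite /drc_weight compatible_compl.
case: ifP => [sD|_]; last by rewrite mulr0.
have r_neq0 : Num.sqrt (1 - p) != 0 by rewrite sqrtr_eq0 -ltNge subr_gt0.
set c := (if _ then _ else _); set r := Num.sqrt _ in r_neq0 *.
have -> : \prod_(x : V) vertex_weight a (config_of_set (~: D) x)
    = c ^+ #|V| * ((1 - a) / a) ^+ #|D|.
  have -> : c ^+ #|V| = \prod_(x : V) c by rewrite prodr_const.
  rewrite -prodr_const [X in _ = _ * X]big_mkcond /= -big_split /=.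
  apply: eq_bigr => x _; rewrite ffunE inE /vertex_weight /c.
  have [->|a_neq1] := eqVneq a 1; case: (x \in D); rewrite ?mulr1 //=.
    by rewrite subrr mul0r mulr0.
  have a'_neq0 : 1 - a != 0 by rewrite subr_eq0 eq_sym.
  by rewrite mulrA divfK // divff // gt_eqF.
(* By compatibility every open edge is available, and closed edges contribute 1. *)
have -> : \prod_(e in available_edges E (config_of_set (~: D)))
      (p / (1 - p)) ^+ config_of_set C e = (p / (1 - p)) ^+ #|C|.
  rewrite -prodr_const [RHS]big_mkcond [LHS]big_mkcond /=.
  apply: eq_bigr => e _; rewrite ffunE.
  have := compatible_compl D C; rewrite sD => /subsetP/(_ e).
  rewrite open_edges_config; case: (e \in C) => [->//|_].
  by case: ifP.
rewrite -(num_components_compl sD) available_edges_compl cardsCs setCK.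
have -> : r ^+ (#|{: edge E}| - #|incident E D|)
    = r ^+ #|{: edge E}| * r^-1 ^+ #|incident E D|.
  by rewrite exprB ?max_card ?unitfE // exprVn.
rewrite /dilution_weight [((1 - a) / a / q) ^+ _]exprMn exprD !exprVn.
have : q ^+ #|D| != 0 by rewrite expf_neq0 ?gt_eqF.
move: (q ^+ #|D|) (q ^+ num_components _ _) (((1 - a) / a) ^+ _) (c ^+ _).
move: (r ^+ #|{: _}|).
move: (r ^- _) (_ ^+ #|C|) => ? ? ? Q ? ? ? Q_neq0.
by field.
Qed.

Definition marginal_weight (a p q : R) C : R :=
  q ^+ components C * (p / (1 - p)) ^+ #|C|
  * dilution_sum ((1 - a) / a / q) (Num.sqrt (1 - p))^-1 C.

Lemma marginal_weight_gt0 (a p q : R) C : 0 < a <= 1 -> 0 < p < 1 -> 0 < q ->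
  0 < marginal_weight a p q C.
Proof.
move=> /andP[a_gt0 a_le1] /andP[p_gt0 p_lt1] q_gt0.
rewrite !mulr_gt0 ?exprn_gt0 ?divr_gt0 ?subr_gt0 //.
apply: dilution_sum_gt0; first by rewrite !divr_ge0 ?subr_ge0 // ltW.
rewrite invf_ge1 ?sqrtr_gt0 ?subr_gt0 // -[leRHS]sqrtr1 ler_wsqrtr //.
by rewrite gerBl ltW.
Qed.

Lemma sum_drc_weight (a p q : R) C : 0 < a <= 1 -> 0 < p < 1 -> 0 < q ->
  \sum_psi drc_weight a p q psi (config_of_set C)
  = (if a == 1 then 1 else a / (1 - a)) ^+ #|V|
    * Num.sqrt (1 - p) ^+ #|{: edge E}| * marginal_weight a p q C.
Proof.
move=> ha hp hq.
have bij : bijective (fun D : {set V} => config_of_set (~: D)).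
  exact: bij_comp (config_of_set_bij V) (inv_bij (@setCK V)).
rewrite (reindex _ (onW_bij _ bij)) /=.
under eq_bigr => D _ do rewrite drc_weight_compl //.
by rewrite -mulr_sumr -big_mkcond -mulr_sumr.
Qed.

Lemma expectation_edge_marginal (a p q : R) f :
  0 < a <= 1 -> 0 < p < 1 -> 0 < q ->
  expectation (edge_marginal a p q) f
  = (\sum_(C : {set edge E}) marginal_weight a p q C * f (config_of_set C))
    / \sum_(C : {set edge E}) marginal_weight a p q C.
Proof.
move=> ha hp hq; have [a_gt0 a_le1] := andP ha; have [p_gt0 p_lt1] := andP hp.
have bij := onW_bij predT (config_of_set_bij (edge E)).
rewrite /expectation /edge_marginal /drc_measure (reindex _ bij) /=.
have -> : drc_partition E a p q
    = \sum_(C : {set edge E}) \sum_psi drc_weight a p q psi (config_of_set C).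
  by rewrite /drc_partition exchange_big (reindex _ bij).
under eq_bigr => C _ do rewrite -mulr_suml sum_drc_weight //.
under eq_bigr => C _ do under eq_bigr => C' _ do rewrite sum_drc_weight //.
rewrite -mulr_sumr.
(* The constant [k] occurs in both the numerator and the partition function. *)
set k := (if _ then _ else _) ^+ _ * _ ^+ _; have k_neq0 : k != 0.
  rewrite mulf_neq0 ?expf_neq0 //; last by rewrite sqrtr_eq0 -ltNge subr_gt0.
  case: (eqVneq a 1) => [_|a_neq1]; first exact: oner_neq0.
  by rewrite mulf_neq0 ?invr_eq0 ?gt_eqF // subr_gt0 lt_neqAle a_neq1.
rewrite mulr_suml; apply: eq_bigr => C _.
rewrite invfM; set Z := (\sum_C _)^-1; field.
by [].
Qed.

End Marginal.

(** * Stochastic comparison *)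

(** The lattice condition for FKG: cardinality is modular, so the powers of [y] agree, and [1 <= q]
    transfers the supermodularity of [components] to the powers of [q]. *)
Lemma random_cluster_supermodular (R : rcfType) (V : finType)
    (E : {set {set V}}) (q y : R) (A B : {set edge E}) :
    simple_graph E -> 1 <= q -> 0 <= y ->
  q ^+ components A * y ^+ #|A| * (q ^+ components B * y ^+ #|B|)
    <= q ^+ components (A :|: B) * y ^+ #|A :|: B|
       * (q ^+ components (A :&: B) * y ^+ #|A :&: B|).
Proof.
move=> hE q_ge1 y_ge0.
rewrite mulrACA [leRHS]mulrACA -!exprD -cardsUI ler_wpM2r ?exprn_ge0 //.
by rewrite ler_weXn2l // components_supermodular.
Qed.

(* When max_degree E = 0 the index delta - 1 is truncated to 0; there is then
   no edge, and both conclusions compare measures on a one-point space. *)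
Theorem theorem6p1 (R : rcfType) (V : finType) (E : {set {set V}})
    (hE : simple_graph E) (a1 a2 p1 p2 q1 q2 : R)
    (ha : 0 < a2 <= a1) (ha1 : a1 = 1)
    (hp1 : 0 < p1 < 1) (hp2 : 0 < p2 < 1)
    (hq1 : 1 <= q1) (hq2 : 1 <= q2) :
  let Upsilon1 := @edge_marginal R V E a1 p1 q1 in
  let Upsilon2 := @edge_marginal R V E a2 p2 q2 in
  let delta := max_degree E in
  let w := w_coef a2 p2 q2 in
  (q2 <= q1 ->
   (1 - p2) / p2 * (1 + 2 * w delta + w delta * w delta.-1)
     <= (1 - p1) / p1 ->
   st_le Upsilon1 Upsilon2)
  /\
  (p1 >= p2 -> q1 <= q2 -> st_le Upsilon2 Upsilon1).
Proof.
move=> Upsilon1 Upsilon2 delta w.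
have q1_gt0 : 0 < q1 by apply: lt_le_trans hq1.
have q2_gt0 : 0 < q2 by apply: lt_le_trans hq2.
rewrite {}ha1 {a1} in ha Upsilon1 *.
have h1 : 0 < (1 : R) <= 1 by rewrite ltr01 lexx.
have [/andP[p1_gt0 p1_lt1] /andP[p2_gt0 p2_lt1]] := (hp1, hp2).
have [a2_gt0 a2_le1] := andP ha.
set y1 := p1 / (1 - p1); set y2 := p2 / (1 - p2).
have y1_gt0 : 0 < y1 by rewrite divr_gt0 ?subr_gt0.
have y2_gt0 : 0 < y2 by rewrite divr_gt0 ?subr_gt0.
set t := (1 - a2) / a2 / q2; set r := Num.sqrt (1 - p2).
have t_ge0 : 0 <= t by rewrite !divr_ge0 ?subr_ge0 // ltW.
have r_gt0 : 0 < r by rewrite sqrtr_gt0 subr_gt0.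
have s_ge1 : 1 <= r^-1.
  by rewrite invf_ge1 // -[leRHS]sqrtr1 ler_wsqrtr // gerBl ltW.
have wE j : w j = t * r^-1 ^+ j.
  by rewrite /w /w_coef -/r div1r invfM exprVn /t mulrC mulrA.
pose m (C : {set edge E}) := q1 ^+ components C * y1 ^+ #|C|.
(* Up to a constant, [n] is the density of [Upsilon2] with respect to [Upsilon1]. *)
pose n (C : {set edge E}) :=
  (q2 / q1) ^+ components C * (y2 / y1) ^+ #|C| * dilution_sum t r^-1 C.
have m_gt0 C : 0 < m C by rewrite mulr_gt0 ?exprn_gt0.
have E1 C : marginal_weight 1 p1 q1 C = m C.
  by rewrite /marginal_weight subrr !mul0r dilution_sum0 mulr1.
have E2 C : marginal_weight a2 p2 q2 C = m C * n C.
  rewrite /marginal_weight -/y2 -/t -/r /m /n mulrA [in RHS]mulrACA -!exprMn.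
  by rewrite [q1 * _]mulrC [y1 * _]mulrC !divfK ?gt_eqF.
have Z1_gt0 : 0 < \sum_C m C.
  by rewrite (bigD1 set0) //= ltr_pwDl // sumr_ge0 // => C _; apply: ltW.
have Z2_gt0 : 0 < \sum_C m C * n C.
  rewrite (bigD1 set0) //= -!E2 ltr_pwDl ?marginal_weight_gt0 // sumr_ge0 //.
  by move=> C _; rewrite -E2 ltW // marginal_weight_gt0.
have Ex1 f : expectation Upsilon1 f
    = (\sum_C m C * f (config_of_set C)) / \sum_C m C.
  rewrite expectation_edge_marginal //.
  by congr (_ / _); apply: eq_bigr => C _; rewrite E1.
have Ex2 f : expectation Upsilon2 f
    = (\sum_C m C * n C * f (config_of_set C)) / \sum_C m C * n C.
  rewrite expectation_edge_marginal //.
  by congr (_ / _); apply: eq_bigr => C _; rewrite E2.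
have m_super A B : m A * m B <= m (A :|: B) * m (A :&: B).
  by apply: random_cluster_supermodular => //; apply: ltW.
have fS f : increasing_fun f -> forall A B : {set edge E}, A \subset B ->
    f (config_of_set A) <= f (config_of_set B).
  move=> fI A B /subsetP sAB; apply: fI => e; rewrite !ffunE.
  by case: (e \in A) (sAB e) => [->|].
have m_ge0 C : 0 <= m C by apply: ltW.
have d_gt0 (C : {set edge E}) : 0 < dilution_sum t r^-1 C.
  exact: dilution_sum_gt0.
have d_ge0 (C : {set edge E}) : 0 <= dilution_sum t r^-1 C by apply: ltW.
have q_ge0 : 0 <= q2 / q1 by apply: divr_ge0; apply: ltW.
have y_ge0 : 0 <= y2 / y1 by apply: divr_ge0; apply: ltW.
have yV p : ((1 - p) / p : R) = (p / (1 - p))^-1 by rewrite invf_div.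
split=> [q21 hw f /fS fI|p21 q12 f /fS fI]; rewrite Ex1 Ex2.
  (* Clearing the positive denominators leaves the FKG inequality for [f] and [n] under [m]. *)
  rewrite ler_pdivrMr // mulrAC ler_pdivlMr //.
  have nS (A B : {set edge E}) : A \subset B -> n A <= n B.
    apply: homo_subset_setU1 => {A B} e C eC.
    have hK : (q2 / q1) ^+ components C <= (q2 / q1) ^+ components (e |: C).
      by rewrite ler_wiXn2l ?components_setU1_le // ler_pdivrMr ?mul1r.
    (* The factor lost by the dilution sum is at most [1 + 2 * w delta + w delta * w delta.-1], and
       [hw] says that this is at most [y2 / y1], the factor gained from the new edge. *)
    have hd : dilution_sum t r^-1 C <= y2 / y1 * dilution_sum t r^-1 (e |: C).
      apply: le_trans (dilution_sum_setU1 t_ge0 s_ge1 C (hE _ (valP e))) _.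
      rewrite -/delta -!wE ler_wpM2r //.
      rewrite !yV -/y1 -/y2 in hw.
      by rewrite -(ler_pM2l (_ : 0 < y2^-1)) ?invr_gt0 // mulKf ?gt_eqF.
    rewrite /n cardsU1 eC exprSr mulrA -[leRHS]mulrA.
    by rewrite ler_pM ?mulr_ge0 ?exprn_ge0 // ler_wpM2r ?exprn_ge0.
  have := fkg m_ge0 m_super fI nS.
  by under [X in _ <= X * _ -> _]eq_bigr => C _ do rewrite [f _ * _]mulrC mulrA.
rewrite ler_pdivrMr // mulrAC ler_pdivlMr //.
have y21 : y2 <= y1.
  by rewrite ler_pdivrMr ?subr_gt0 // mulrAC ler_pdivlMr ?subr_gt0 //; lra.
(* All three factors of [n] now decrease, so FKG is applied to [- n]. *)
have nS (A B : {set edge E}) : A \subset B -> - n A <= - n B.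
  apply: (homo_subset_setU1 (f := fun C => - n C)) => {A B} e C eC.
  have hK : (q2 / q1) ^+ components (e |: C) <= (q2 / q1) ^+ components C.
    by rewrite ler_weXn2l ?components_setU1_le // ler_pdivlMr ?mul1r.
  have hy : (y2 / y1) ^+ #|e |: C| <= (y2 / y1) ^+ #|C|.
    apply: ler_wiXn2l => //; first by rewrite ler_pdivrMr ?mul1r.
    by rewrite subset_leq_card ?subsetUr.
  rewrite lerN2 /n ler_pM ?mulr_ge0 ?exprn_ge0 //.
    by rewrite ler_pM ?exprn_ge0.
  by apply: dilution_sumS => //; apply: subsetUr.
have := fkg m_ge0 m_super fI nS.
have -> : \sum_C m C * - n C = - \sum_C m C * n C.
  by rewrite -sumrN; apply: eq_bigr => C _; rewrite mulrN.
have -> : \sum_C m C * (f (config_of_set C) * - n C)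
    = - \sum_C m C * n C * f (config_of_set C).
  by rewrite -sumrN; apply: eq_bigr => C _; rewrite !mulrN mulrCA mulrC.
by rewrite mulrN mulNr lerN2.
Qed.
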